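(* Let $(V,\mu,\alpha)$ be a multiplicative Hom-Jordan algebra over a field $F$. Then $GDer(V)=QDer(V)+QC(V)$.
   Context: A Hom-Jordan algebra over a field $F$ is a triple $(V,\mu,\alpha)$: a vector space $V$, a commutative bilinear map $\mu:V\times V\to V$ and a linear map $\alpha:V\to V$ with $\mu(\alpha^2(x),\mu(y,\mu(x,x)))=\mu(\mu(\alpha(x),y),\alpha(\mu(x,x)))$ for all $x,y\in V$. It is multiplicative if $\alpha(\mu(x,y))=\mu(\alpha(x),\alpha(y))$ for all $x,y$. Let $\mathcal{W}=\{w\in End(V): w\circ\alpha=\alpha\circ w\}$. For each integer $k\ge 0$ (with $\alpha^0=id$), define subsets of $\mathcal{W}$; conditions are for all $x,y\in V$: - $GDer_{\alpha^k}(V)$ (generalized $\alpha^k$-derivations): $D\in\mathcal{W}$ such that there are $D',D''\in\mathcal{W}$ with $\mu(D(x),\alpha^k(y))+\mu(\alpha^k(x),D'(y))=D''(\mu(x,y))$. - $QDer_{\alpha^k}(V)$ ($\alpha^k$-quasiderivations): $D\in\mathcal{W}$ such that there is $D'\in\mathcal{W}$ with $\mu(D(x),\alpha^k(y))+\mu(\alpha^k(x),D(y))=D'(\mu(x,y))$. - $QC_{\alpha^k}(V)$ ($\alpha^k$-quasicentroids): $D\in\mathcal{W}$ with $\mu(D(x),\alpha^k(y))=\mu(\alpha^k(x),D(y))$. For each of these families $A_{\alpha^k}(V)$ write $A(V)=\dotplus_{k\ge0}A_{\alpha^k}(V)$, a direct sum graded by $k$; sums and equalities of these graded spaces are read degree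 by degree.
   Formalization: The field F is assumed to have characteristic different from 2; over any field of characteristic 2 the equality fails, e.g. for V = F^3, α = id, μ(x,y) = (0,0,x_0y_0+x_1y_1), k = 0, where D(x) = (x_1,0,0) is in GDer(V) but not in QDer(V)+QC(V). *)

(* Defs.v *)
From HB Require Import structures.
From mathcomp Require Import all_boot all_order all_algebra.

Set Implicit Arguments.
Unset Strict Implicit.
Unset Printing Implicit Defensive.

Import GRing.Theory.
Local Open Scope ring_scope.

Record homJordan (F : fieldType) (V : lmodType F) := HomJordan {
  hj_mul : {bilinear V -> V -> V};
  hj_twist : {linear V -> V};
  hj_mulC : forall x y : V, hj_mul x y = hj_mul y x;
  hj_identity : forall x y : V,
    hj_mul (hj_twist (hj_twist x)) (hj_mul y (hj_mul x x)) =
    hj_mul (hj_mul (hj_twist x) y) (hj_twist (hj_mul x x))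
}.

Section HomJordanDerivations.
Variables (F : fieldType) (V : lmodType F) (J : homJordan V).

Local Notation mu := (hj_mul J).
Local Notation alpha := (hj_twist J).

Definition hj_multiplicative : Prop :=
  forall x y : V, alpha (mu x y) = mu (alpha x) (alpha y).

Definition twist_comm (w : {linear V -> V}) : Prop :=
  forall x : V, w (alpha x) = alpha (w x).

Definition GDer (k : nat) (D : {linear V -> V}) : Prop :=
  twist_comm D /\
  exists D' D'' : {linear V -> V},
    [/\ twist_comm D', twist_comm D'' &
      forall x y : V,
        mu (D x) (iter k alpha y) + mu (iter k alpha x) (D' y) = D'' (mu x y)].

Definition QDer (k : nat) (D : {linear V -> V}) : Prop :=
  twist_comm D /\
  exists2 D' : {linear V -> V},
    twist_comm D' &
    forall x y : V,
      mu (D x) (iter k alpha y) + mu (iter k alpha x) (D y) = D' (mu x y).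

Definition QC (k : nat) (D : {linear V -> V}) : Prop :=
  twist_comm D /\
  forall x y : V, mu (D x) (iter k alpha y) = mu (iter k alpha x) (D y).

End HomJordanDerivations.

(* A graded family A stands for the external direct sum over k of the A k:
   the same endomorphism occurring in two degrees gives two distinct
   elements.  Sums and equalities are therefore taken degree by degree. *)
Definition graded_end (F : fieldType) (V : lmodType F) : Type :=
  nat -> {linear V -> V} -> Prop.

Definition graded_add (F : fieldType) (V : lmodType F)
    (A B : graded_end V) : graded_end V :=
  fun k D => exists D1 D2 : {linear V -> V},
    [/\ A k D1, B k D2 & forall x : V, D x = D1 x + D2 x].

Definition graded_eq (F : fieldType) (V : lmodType F)
    (A B : graded_end V) : Prop :=
  forall (k : nat) (D : {linear V -> V}), A k D <-> B k D.

(* Main.v *)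
Require Import Defs.
From mathcomp Require Import all_boot all_order all_algebra.

Local Open Scope ring_scope.

(** Commutativity of the product gives an involution (D, D') |-> (D', D) on
    the pairs of maps witnessing a generalized derivation with a fixed D'':
    exchange x and y in the defining identity.  Since 2 is invertible, D splits
    into its even half (D + D') / 2 and its odd half (D - D') / 2.  Adding the
    identity to its mirror image says that the even half is a quasiderivation
    for the same D''; subtracting them says that the odd half is a
    quasicentroid element.  Conversely, for D1 a quasiderivation and D2 in the
    quasicentroid, the pair (D1 + D2, D1 - D2) witnesses that D1 + D2 is a
    generalized derivation, the two D2 terms cancelling. *)

Import GRing.Theory.

Section Decomposition.
Variables (F : fieldType) (V : lmodType F) (J : homJordan V).

Local Notation mu := (hj_mul J).
Local Notation alpha := (hj_twist J).

Lemma twist_comm_lincomb (a b : F) (f g : {linear V -> V}) :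
  twist_comm J f -> twist_comm J g ->
  twist_comm J ((a \*: f) \+ (b \*: g)).
Proof. by move=> fC gC x /=; rewrite fC gC linearD !linearZ. Qed.

(** The product is commutative, so reading the identity at (y, x) moves D to
    the second factor and D' to the first. *)
Lemma gder_identity_swap (k : nat) (D D' D'' : V -> V) :
  (forall x y, mu (D x) (iter k alpha y) + mu (iter k alpha x) (D' y)
               = D'' (mu x y)) ->
  forall x y, mu (D' x) (iter k alpha y) + mu (iter k alpha x) (D y)
              = D'' (mu x y).
Proof.
move=> DE x y.
by rewrite (hj_mulC J x) -DE addrC (hj_mulC J (D y)) (hj_mulC J (D' x)).
Qed.

Lemma GDer_split (k : nat) (D : {linear V -> V}) :
  2%N \notin [pchar F] -> GDer J k D -> graded_add (QDer J) (QC J) k D.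
Proof.
move=> char_neq2 [DC [D' [D'' [D'C D''C DE]]]].
have two_neq0 : 2%:R != 0 :> F by move: char_neq2; rewrite inE.
have D'E := gder_identity_swap _ _ _ _ DE.
pose h : F := 2%:R^-1.
have half2 (v : V) : h *: v + h *: v = v.
  by rewrite -scalerDl -mulr2n -mulr_natr mulVf // scale1r.
exists ((h \*: D) \+ (h \*: D')), ((h \*: D) \+ ((- h) \*: D')); split.
- split; first exact: twist_comm_lincomb.
  exists D'' => // x y /=.
  rewrite linearDl linearDr /= !linearZl_LR !linearZr_LR /=.
  by rewrite [X in _ + X]addrC addrACA -!scalerDr DE D'E scalerDr half2.
- split; first exact: twist_comm_lincomb.
  move=> x y /=.
  rewrite linearDl linearDr /= !linearZl_LR !linearZr_LR /= !scaleNr -!scalerBr.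
  congr (_ *: _).
  (* Both the identity and its mirror image evaluate to D'' (mu x y). *)
  by apply/eqP; rewrite subr_eq addrAC eq_sym subr_eq DE addrC D'E.
- by move=> x /=; rewrite scaleNr addrACA subrr addr0 half2.
Qed.

Lemma QDer_add_QC (k : nat) (D : {linear V -> V}) :
  graded_add (QDer J) (QC J) k D -> GDer J k D.
Proof.
move=> [D1 [D2 [[D1C [D'' D''C D1E]] [D2C D2E] DE]]].
split; first by move=> x; rewrite !DE D1C D2C linearD.
(* The sign makes the two D2 terms opposite, by the quasicentroid law. *)
exists ((1 \*: D1) \+ ((- 1) \*: D2)), D''; split=> //.
  exact: twist_comm_lincomb.
move=> x y /=.
rewrite DE scale1r scaleN1r linearDl linearBr /= D2E.
by rewrite addrACA subrr addr0 D1E.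
Qed.

End Decomposition.

(* Characteristic 2 is excluded, as is standard for Jordan algebras: the
   equality fails there, e.g. for alpha = id on F^3 with
   mu x y = (0, 0, x_0 y_0 + x_1 y_1), k = 0 and D x = (x_1, 0, 0). *)
Theorem theorem3p3 (F : fieldType) (V : lmodType F) (J : homJordan V)
    (char_neq2 : 2%N \notin [pchar F]) (J_mult : hj_multiplicative J) :
  graded_eq (GDer J) (graded_add (QDer J) (QC J)).
Proof. by move=> k D; split; [exact: GDer_split | exact: QDer_add_QC]. Qed.
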